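(* Let $s\ge 3$ be an integer and let \[ p_s(x) = \frac{1-x^s}{(1-x)(1-2\cos(2\pi/s)x+x^2)}. \] Then: (a) $p_s(x)$ is a palindromic polynomial of degree $s-3$ (i.e. $x^{s-3}p_s(1/x)=p_s(x)$); (b) the coefficients $a_0,\dots,a_{s-3}$ of $p_s(x)$ are positive; (c) the coefficients of $p_s(x)$ are fixed by $\mathcal{L}$; (d) the coefficients of $p_s(x)$ are $\infty$-log-concave; (e) for real $r\ge1$, the coefficients of $p_s(x)$ are $r$-factor log-concave if and only if \[ r\le \begin{cases} \dfrac{1}{\cos(2\pi/s)}, & \text{if $s$ is even},\\[2mm] \dfrac{1}{[1-2\cos(\pi/s)]^2}, & \text{if $s$ is odd},\end{cases} \] where for $s\in\{3,4\}$ (where the denominator vanishes) the right-hand side is interpreted as $+\infty$.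
   Context: For a sequence $(a_n)_{n\ge0}$ (the coefficient sequence of a polynomial is extended by $a_n=0$ beyond its degree, and $a_{-1}=0$), $\mathcal{L}$ denotes the operator sending $(a_n)$ to $(a_n^2-a_{n-1}a_{n+1})_{n\ge0}$. A sequence is fixed by $\mathcal{L}$ if $\mathcal{L}(a_n)=(a_n)$. A sequence is $m$-log-concave if $\mathcal{L}^j(a_n)\ge0$ (termwise) for all $j=0,1,\dots,m$, and $\infty$-log-concave if it is $m$-log-concave for all $m$. For $r\ge1$, a sequence is $r$-factor log-concave if $a_n^2\ge r\,a_{n-1}a_{n+1}$ for all $n$. *)

(* Defs.v *)
From mathcomp Require Import all_boot all_order all_algebra.
From mathcomp Require Import reals constructive_ereal trigo.

Set Implicit Arguments.
Unset Strict Implicit.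
Unset Printing Implicit Defensive.

Import GRing.Theory.
Local Open Scope ring_scope.

Section LogConcavity.
Variable R : realType.
Implicit Types a : nat -> R.

(* The term a_{n-1}, with the convention a_{-1} = 0. *)
Definition prev_term a (n : nat) : R := if n is m.+1 then a m else 0.

Definition logL a : nat -> R := fun n => a n ^+ 2 - prev_term a n * a n.+1.

Definition fixed_by_logL a : Prop := forall n, logL a n = a n.

Definition log_concave (m : nat) a : Prop :=
  forall j, (j <= m)%N -> forall n, 0 <= iter j logL a n.

Definition infinitely_log_concave a : Prop := forall m, log_concave m a.

Definition factor_log_concave (r : R) a : Prop :=
  forall n, r * (prev_term a n * a n.+1) <= a n ^+ 2.

End LogConcavity.

Section Ps.
Variable R : realType.

(* A coefficient of {poly R} beyond the size is 0, so this is the coefficient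
   sequence extended by zeros. *)
Definition coef_seq (p : {poly R}) : nat -> R := fun n => p`_n.

(* p_s as an element of the field of rational functions R(x); that it is a
   polynomial is part of what has to be proved. *)
Definition p_frac (s : nat) : {fraction {poly R}} :=
  FracField.tofrac (1 - 'X^s) /
  FracField.tofrac
    ((1 - 'X) * (1 - (2 * cos (2 * pi / s%:R)) *: 'X + 'X^2)).

(* x^d p(1/x) = p(x), as functions on R \ {0}, where d is the degree of p. *)
Definition palindromic (p : {poly R}) : Prop :=
  forall x : R, x != 0 -> x ^+ (size p).-1 * p.[x^-1] = p.[x].

(* The vanishing denominators at s = 4 (even) and s = 3 (odd) give +oo. *)
Definition factor_bound (s : nat) : \bar R :=
  if odd s then
    if s == 3 then +oo%E
    else (1 / (1 - 2 * cos (pi / s%:R)) ^+ 2)%:E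
  else
    if s == 4 then +oo%E
    else (1 / cos (2 * pi / s%:R))%:E.

End Ps.

(* Main.v *)
(** Put [h = pi / s] and [S k = sin (k h)].  The coefficients are
    [a_n = S (n+1) S (n+2) / (S 1 S 2)]: they satisfy the linear recurrence
    attached to the denominator of [p_s] and are [s]-periodic, so the product with
    the denominator telescopes to [1 - x^s].  The identity
    [S (k+1) S (k+2) - S k S (k+3) = S 1 S 2] says that they are fixed by [L].
    For a nonnegative fixed sequence [a_(n-1) a_(n+1) = a_n^2 - a_n], so
    [r]-factor log-concavity becomes [(r - 1) a_n <= r] for all [n]: only the
    largest coefficient matters.  Since
    [2 S k S (k+1) = cos h - cos ((2k+1) h)], it is attained at the middle, where
    the last cosine is [-1] ([s] odd) or [- cos h] ([s] even). *)
Require Import Defs.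
From mathcomp Require Import all_boot all_order all_algebra.
From mathcomp Require Import reals constructive_ereal trigo.
From mathcomp Require Import ring lra zify.

Set Implicit Arguments.
Unset Strict Implicit.
Unset Printing Implicit Defensive.

Import Order.TTheory GRing.Theory Num.Theory.

Local Open Scope ring_scope.

(** * Nonnegative sequences fixed by [logL] *)

Section FixedSequences.
Context {R : realType}.
Implicit Types (a : nat -> R) (r m : R).

Lemma eq_logL a a' : a =1 a' -> logL a =1 logL a'.
Proof. by move=> eqa [|n]; rewrite /logL /prev_term !eqa. Qed.

Lemma iter_logL_fixed a j : fixed_by_logL a -> iter j (@logL R) a =1 a.
Proof.
move=> fa; elim: j => [//|j IHj] n.
by rewrite iterS (eq_logL IHj) fa.
Qed.

Lemma fixed_infinitely_log_concave a :
  fixed_by_logL a -> (forall n, 0 <= a n) -> infinitely_log_concave a.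
Proof. by move=> fa a_ge0 m j _ n; rewrite iter_logL_fixed. Qed.

(** Here [m] is the reciprocal of the largest term, attained at [n0]; at that term
    [(r - 1) a_n <= r] reads [r - 1 <= r m]. *)
Lemma factor_log_concave_fixed a r m n0 :
    fixed_by_logL a -> (forall n, 0 <= a n) -> 0 < m ->
    (forall n, a n * m <= 1) -> a n0 * m = 1 -> 1 <= r ->
  factor_log_concave r a <-> r * (1 - m) <= 1.
Proof.
move=> fa a_ge0 m_gt0 am_le1 am1 r_ge1.
have prodE n : prev_term a n * a n.+1 = a n ^+ 2 - a n.
  by have := fa n; rewrite /logL; lra.
split=> [/(_ n0)|rm n]; rewrite prodE.
- have a_gt0 : 0 < a n0.
    by rewrite lt_def a_ge0 andbT; apply/eqP => a0; move: am1; rewrite a0; lra.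
  (* Scaling by [m ^ 2] makes [a n0] occur only in the product [a n0 * m = 1]. *)
  rewrite -(ler_pM2r (mulr_gt0 m_gt0 m_gt0)).
  have -> : r * (a n0 ^+ 2 - a n0) * (m * m) =
            r * ((a n0 * m) ^+ 2 - (a n0 * m) * m) by ring.
  have -> : a n0 ^+ 2 * (m * m) = (a n0 * m) ^+ 2 by ring.
  by rewrite am1; lra.
- rewrite -(ler_pM2r m_gt0).
  have -> : r * (a n ^+ 2 - a n) * m = a n * (r * (a n * m - m)) by ring.
  have -> : a n ^+ 2 * m = a n * (a n * m) by ring.
  apply: ler_wpM2l => //.
  (* This is where [1 <= r] enters: [(r - 1) a_n m <= r - 1 <= r m]. *)
  have : (r - 1) * (a n * m) <= (r - 1) * 1 by apply: ler_wpM2l; [lra|exact: am_le1].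
  by lra.
Qed.

End FixedSequences.

(** * Identities for products of consecutive sines, at an arbitrary angle *)

Section SineProducts.
Context {R : realType}.
Implicit Types (h : R) (k n N : nat).

Definition msin h k : R := sin (k%:R * h).

Definition sin_quot h k : R :=
  msin h k * msin h k.+1 / (msin h 1 * msin h 2).

Lemma cos_double h : cos (2 * h) = 2 * cos h ^+ 2 - 1.
Proof. by rewrite !mulr_natl cos_mulr2n. Qed.

Lemma msin0 h : msin h 0 = 0.
Proof. by rewrite /msin mul0r sin0. Qed.

Lemma msin1 h : msin h 1 = sin h.
Proof. by rewrite /msin mul1r. Qed.

Lemma msinSS h k : msin h k.+2 = 2 * cos h * msin h k.+1 - msin h k.
Proof.
rewrite /msin.
have -> : k.+2%:R * h = k.+1%:R * h + h by rewrite -(natr1 k.+1); ring.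
have -> : k%:R * h = k.+1%:R * h - h by rewrite -(natr1 k); ring.
by rewrite sinD sinB; ring.
Qed.

Lemma msin2 h : msin h 2 = 2 * cos h * sin h.
Proof. by rewrite msinSS msin0 msin1 subr0. Qed.

(** Both products of sines contain the same [cos ((2k+3) h)], so their difference is free of [k].
    The proof expands in the sine and cosine of [k h] and [h] and reduces by Pythagoras. *)
Lemma msin_exchange h k :
  msin h k.+1 * msin h k.+2 = msin h k * msin h k.+3 + msin h 1 * msin h 2.
Proof.
have cs := cos2Dsin2 (k%:R * h).
rewrite msin2 msin1 (msinSS h k.+1) !(msinSS h k) /msin.
have -> : k.+1%:R * h = k%:R * h + h by rewrite -natr1; ring.
rewrite sinD.
set y := sin _ in cs *; set z := cos (_ * _) in cs *.
have ch := cos2Dsin2 h.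
set c := cos h in ch *; set d := sin h in ch *.
have y2 : y ^+ 2 = 1 - z ^+ 2 by rewrite -cs; ring.
have c2 : c ^+ 2 = 1 - d ^+ 2 by rewrite -ch; ring.
by ring: y2 c2.
Qed.

Lemma msin_prod h k :
  2 * (msin h k * msin h k.+1) = cos h - cos ((2 * k + 1)%:R * h).
Proof.
have -> : cos h = cos (k.+1%:R * h - k%:R * h) by congr cos; rewrite -natr1; ring.
have -> : (2 * k + 1)%:R * h = k.+1%:R * h + k%:R * h.
  by rewrite natrD natrM -natr1; ring.
by rewrite /msin cosB cosD; ring.
Qed.

(** The characteristic polynomial is [(x - 1)(x^2 - 2 cos(2h) x + 1) = x^3 - e x^2 + e x - 1]: by
    product-to-sum, [sin_quot] is a constant plus a wave of frequency [2h]. *)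
Lemma sin_quot_rec h k :
  let e := 1 + 2 * cos (2 * h) in
  sin_quot h k.+3 = e * sin_quot h k.+2 - e * sin_quot h k.+1 + sin_quot h k.
Proof.
rewrite /= cos_double /sin_quot (msinSS h k.+2) (msinSS h k.+1) !(msinSS h k).
by ring.
Qed.

(** The denominator is [1 - e x + e x^2 - x^3], so the recurrence cancels all interior terms and
    only the two ends of the truncated series survive. *)
Lemma sin_quot_gen_poly h N : msin h 1 * msin h 2 != 0 ->
  let e := 1 + 2 * cos (2 * h) in let b := sin_quot h in
  (\sum_(i < N) b i.+1 *: 'X^i) *
    ((1 - 'X) * (1 - (2 * cos (2 * h)) *: 'X + 'X^2)) =
  1 - b N.+1 *: 'X^N - (b N.+2 - e * b N.+1) *: 'X^(N.+1) - b N *: 'X^(N.+2).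
Proof.
move=> K0 e b.
have b0 : b 0 = 0 by rewrite /b /sin_quot msin0 !mul0r.
have b1 : b 1 = 1 by rewrite /b /sin_quot divff.
have b2 : b 2 = e.
  apply: (mulIf K0); rewrite /b /sin_quot divfK // /e cos_double.
  by rewrite (msinSS h 1) msin2 msin1; ring.
elim: N => [|N IHN].
  by rewrite big_ord0 b0 b1 b2 scale1r mulr1 mul0r !(scale0r, subrr, subr0).
rewrite big_ord_recr /= mulrDl IHN /b sin_quot_rec -/b -/e.
have -> : 2 * cos (2 * h) = e - 1 by rewrite /e; ring.
rewrite -!mul_polyC !(rmorphD, rmorphB, rmorphM, rmorphN, rmorph1) /= !exprS.
by ring.
Qed.

End SineProducts.

(** * The angle [pi / s] and the polynomial it defines *)

Section RootsOfUnityAngle.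
Context {R : realType}.
Variables (s : nat) (hs : (3 <= s)%N).

Let h : R := pi / s%:R.
Local Notation K := (msin h 1 * msin h 2).

Lemma natr_s_gt0 : 0 < s%:R :> R.
Proof. by rewrite ltr0n; lia. Qed.

Lemma mul_s_angle : s%:R * h = pi.
Proof. by rewrite /h mulrC divfK // gt_eqF ?natr_s_gt0. Qed.

Lemma angle_gt0 : 0 < h.
Proof. by rewrite divr_gt0 ?pi_gt0 ?natr_s_gt0. Qed.

Lemma msin_reflect k : (k <= s)%N -> msin h (s - k) = msin h k.
Proof.
by move=> ks; rewrite /msin natrB // mulrBl mul_s_angle sinB sinpi cospi; ring.
Qed.

Lemma msin_antiperiod k : msin h (s + k) = - msin h k.
Proof. by rewrite /msin natrD mulrDl mul_s_angle sinD sinpi cospi; ring. Qed.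

Lemma msin_s : msin h s = 0.
Proof. by rewrite /msin mul_s_angle sinpi. Qed.

Lemma msin_gt0 k : (0 < k < s)%N -> 0 < msin h k.
Proof.
case/andP=> k0 ks; apply: sin_gt0_pi; rewrite mulr_gt0 ?ltr0n ?angle_gt0 //=.
by rewrite -mul_s_angle ltr_pM2r ?angle_gt0 // ltr_nat.
Qed.

Lemma msin_ge0 k : (k <= s)%N -> 0 <= msin h k.
Proof.
case: k => [|k] ks; first by rewrite msin0.
have [->|ks'] := eqVneq k.+1 s; first by rewrite msin_s.
by apply/ltW/msin_gt0; lia.
Qed.

Lemma sin_quot_den_gt0 : 0 < K.
Proof. by rewrite mulr_gt0 // msin_gt0 //; lia. Qed.

(** Read off from [sin 2h = 2 cos h sin h > 0], as [2 < s]. *)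
Lemma cos_angle_gt0 : 0 < cos h.
Proof.
have := @msin_gt0 2; rewrite msin2 -msin1 pmulr_lgt0 ?msin_gt0 ?pmulr_rgt0 //; try lia.
by apply; lia.
Qed.

Lemma cos_angle_lt1 : cos h < 1.
Proof.
rewrite lt_def cos_le1 andbT; apply/eqP => c1.
have := @msin_gt0 1; rewrite msin1 => /(_ ltac:(lia)).
by have := cos2Dsin2 h; rewrite -c1; nra.
Qed.

Lemma sin_quot_gt0 k : (0 < k < s.-1)%N -> 0 < sin_quot h k.
Proof.
by move=> ks; rewrite divr_gt0 ?sin_quot_den_gt0 // mulr_gt0 // msin_gt0 //; lia.
Qed.

(** Taking [s] terms lets the telescoped product end at [x^s]; the last two coefficients vanish
    because each contains [sin (s h) = 0]. *)
Definition p_poly : {poly R} := \poly_(i < s) sin_quot h i.+1.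

Lemma coef_p_poly n : (n < s)%N -> p_poly`_n = sin_quot h n.+1.
Proof. by move=> ns; rewrite coef_poly ns. Qed.

Lemma coef_p_poly_eq0 n : (s - 3 < n)%N -> p_poly`_n = 0.
Proof.
move=> sn; rewrite coef_poly; case: ifP => // ns.
have [e|e] : n.+1 = s \/ n.+2 = s by lia.
  by rewrite /sin_quot e msin_s !mul0r.
by rewrite /sin_quot e msin_s mulr0 mul0r.
Qed.

Lemma coef_p_poly_gt0 n : (n <= s - 3)%N -> 0 < p_poly`_n.
Proof. by move=> ns; rewrite coef_p_poly ?sin_quot_gt0 //; lia. Qed.

Lemma coef_p_poly_ge0 n : 0 <= p_poly`_n.
Proof.
have [ns|sn] := leqP n (s - 3); first exact/ltW/coef_p_poly_gt0.
by rewrite coef_p_poly_eq0.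
Qed.

Lemma size_p_poly : size p_poly = (s - 3).+1.
Proof.
have -> : p_poly = \poly_(i < (s - 3).+1) sin_quot h i.+1.
  apply/polyP => n; rewrite [RHS]coef_poly ltnS.
  have [ns|sn] := leqP n (s - 3); first by rewrite coef_p_poly //; lia.
  by rewrite coef_p_poly_eq0.
by apply: size_poly_eq; rewrite gt_eqF // sin_quot_gt0 //; lia.
Qed.

Lemma coef_p_poly_sym n : (n <= s - 3)%N -> p_poly`_(s - 3 - n) = p_poly`_n.
Proof.
move=> ns; rewrite !coef_p_poly; try lia.
(* Reflection [k -> s - k] swaps the two sine factors of the coefficient. *)
have -> : (s - 3 - n).+1 = (s - n.+2)%N by lia.
rewrite /sin_quot; have -> : (s - n.+2).+1 = (s - n.+1)%N by lia.
by rewrite !msin_reflect; try lia; rewrite (mulrC (msin h n.+2)).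
Qed.

Lemma palindromic_p_poly : palindromic p_poly.
Proof.
move=> x x0; rewrite !horner_coef size_p_poly /= mulr_sumr.
rewrite (reindex_inj rev_ord_inj) /=; apply: eq_bigr => i _.
have hi : (i <= s - 3)%N by rewrite -ltnS.
rewrite subSS coef_p_poly_sym // mulrCA; congr (_ * _).
by rewrite exprVn -expfB_cond ?(negPf x0) ?subKn ?leq_subr //=; lia.
Qed.

Lemma fixed_p_poly : fixed_by_logL (coef_seq p_poly).
Proof.
move=> n; rewrite /logL /coef_seq.
have [ns|sn] := leqP n (s - 3); last first.
  by rewrite (coef_p_poly_eq0 sn) (coef_p_poly_eq0 (leqW sn)); ring.
(* The convention [a_(-1) = 0] agrees with [sin_quot h 0 = 0], so [n = 0] needs no separate
   treatment. *)
have -> : prev_term (fun n => p_poly`_n) n = sin_quot h n.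
  case: n ns => [|n] ns /=; first by rewrite /sin_quot msin0 !mul0r.
  by rewrite coef_p_poly //; lia.
rewrite !coef_p_poly; try lia.
have K0 : K != 0 by rewrite gt_eqF ?sin_quot_den_gt0.
have := msin_exchange h n; rewrite /sin_quot => E.
move: K0 E; set k := K => K0 E.
have {}E : msin h n * msin h n.+3 = msin h n.+1 * msin h n.+2 - k by rewrite E addrK.
rewrite mulrACA -invfM.
have -> : msin h n * msin h n.+1 * (msin h n.+2 * msin h n.+3) =
          msin h n.+1 * msin h n.+2 * (msin h n * msin h n.+3) by ring.
by rewrite E; field.
Qed.

Lemma tofrac_p_poly : FracField.tofrac p_poly = p_frac R s.
Proof.
rewrite /p_frac; set D := (1 - 'X) * _.
have -> : 1 - 'X^s = p_poly * D :> {poly R}.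
  rewrite /D -mulrA -/h /p_poly poly_def sin_quot_gen_poly; last first.
    by rewrite gt_eqF ?sin_quot_den_gt0.
  (* At [N = s], periodicity gives the boundary values [0, 1, e] of indices [0, 1, 2], which leaves
     [1 - x^s]. *)
  have -> : sin_quot h s = 0 by rewrite /sin_quot msin_s !mul0r.
  have bD k : sin_quot h (s + k) = sin_quot h k.
    by rewrite /sin_quot -addnS !msin_antiperiod mulrNN.
  have K0 : K != 0 by rewrite gt_eqF ?sin_quot_den_gt0.
  have -> : sin_quot h s.+1 = 1 by rewrite -addn1 bD /sin_quot divff.
  have -> : sin_quot h s.+2 = 1 + 2 * cos (2 * h).
    rewrite -addn2 bD; apply: (mulIf K0); rewrite divfK // cos_double.
    by rewrite (msinSS h 1) msin2 msin1; ring.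
  by rewrite mulr1 subrr !scale0r !subr0 scale1r.
rewrite tofracM mulfK // tofrac_eq0; apply/eqP => D0.
(* The denominator is nonzero since its value at [0] is [1]. *)
have := congr1 (fun q : {poly R} => q.[0]) D0.
by rewrite /D !hornerE /=; lra.
Qed.

(** * The largest coefficient and the factor bound *)

Lemma sin_quot_le M m k : msin h k * msin h k.+1 <= M -> 0 < m -> M * m = K ->
  sin_quot h k * m <= 1.
Proof.
move=> PM m0 MmK; rewrite mulrAC ler_pdivrMr ?sin_quot_den_gt0 // mul1r.
by rewrite -MmK ler_pM2r.
Qed.

Lemma coef_p_poly_le M m :
    0 < m -> M * m = K ->
    (forall k, (k < s)%N -> msin h k * msin h k.+1 <= M) ->
  forall n, p_poly`_n * m <= 1.
Proof.
move=> m0 MmK PM n; have [ns|sn] := leqP n (s - 3).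
  by rewrite coef_p_poly; [apply: (sin_quot_le _ m0 MmK); apply: PM|]; lia.
by rewrite coef_p_poly_eq0 // mul0r.
Qed.

Lemma sqr_sin_angle : sin h ^+ 2 = (1 - cos h) * (1 + cos h).
Proof. by rewrite sin2cos2; ring. Qed.

Lemma factor_p_poly_odd r : odd s -> 1 <= r ->
  factor_log_concave r (coef_seq p_poly) <-> r * (1 - 2 * cos h) ^+ 2 <= 1.
Proof.
move=> s_odd r1.
have c0 := cos_angle_gt0; have c1 := cos_angle_lt1.
(* [M] is the largest sine product, where [cos ((2k+1) h) = -1], and [m = K / M]. *)
pose m := 4 * cos h * (1 - cos h); pose M := (1 + cos h) / 2.
have m0 : 0 < m by rewrite !mulr_gt0 // subr_gt0.
have MmK : M * m = K.
  have -> : K = 2 * cos h * sin h ^+ 2 by rewrite msin2 msin1; ring.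
  by rewrite sqr_sin_angle /M /m; field.
have -> : (1 - 2 * cos h) ^+ 2 = 1 - m by rewrite /m; ring.
have sE : s = (2 * s./2 + 1)%N by lia.
(* Coefficient [n] carries sine index [n + 1], so this is [k = s./2], for which
   [(2k+1) h = s h = pi]. *)
apply: (factor_log_concave_fixed (n0 := s./2.-1)) => //.
- exact: fixed_p_poly.
- exact: coef_p_poly_ge0.
- apply: (coef_p_poly_le m0 MmK) => k _.
  by have := msin_prod h k; have := cos_geN1 ((2 * k + 1)%:R * h); rewrite /M; lra.
- rewrite /coef_seq coef_p_poly; last lia.
  rewrite prednK; last lia.
  have P : msin h s./2 * msin h s./2.+1 = M.
    by have := msin_prod h s./2; rewrite -sE mul_s_angle cospi /M; lra.
  by rewrite /sin_quot P mulrAC MmK divff // gt_eqF ?sin_quot_den_gt0.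
Qed.

Lemma factor_p_poly_even r : ~~ odd s -> 1 <= r ->
  factor_log_concave r (coef_seq p_poly) <-> r * cos (2 * h) <= 1.
Proof.
move=> s_even r1.
have c0 := cos_angle_gt0; have c1 := cos_angle_lt1.
(* [m = K / cos h], where [cos h] is the largest sine product, attained when [k h = pi / 2]. *)
pose m := 2 * sin h ^+ 2.
have m0 : 0 < m by rewrite /m sqr_sin_angle !mulr_gt0 //; lra.
have MmK : cos h * m = K by rewrite msin2 msin1 /m; ring.
have -> : cos (2 * h) = 1 - m by rewrite cos_double /m sin2cos2; ring.
have sE : s = (2 * s./2)%N by lia.
have halfE : s./2%:R * h = pi / 2.
  by rewrite -mul_s_angle {2}sE natrM; field.
have P k : msin h k * msin h k.+1 = cos h - cos (k%:R * h) * cos (k.+1%:R * h).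
  have -> : cos h = cos (k.+1%:R * h - k%:R * h) by congr cos; rewrite -natr1; ring.
  by rewrite cosB /msin; ring.
have cos_ge0 k : (k <= s./2)%N -> 0 <= cos (k%:R * h).
  move=> ks; apply: cos_ge0_pihalf; rewrite -halfE ler_pM2r ?angle_gt0 //.
  rewrite ler_nat ks andbT.
  have := mulr_ge0 (ler0n R k) (ltW angle_gt0).
  by have := mulr_ge0 (ler0n R s./2) (ltW angle_gt0); lra.
have cos_le0 k : (s./2 <= k <= s)%N -> cos (k%:R * h) <= 0.
  case/andP=> sk ks; have := @cos_ge0 (s - k)%N ltac:(lia).
  by rewrite natrB // mulrBl mul_s_angle cosB cospi sinpi; lra.
apply: (factor_log_concave_fixed (n0 := s./2.-1)) => //.
- exact: fixed_p_poly.
- exact: coef_p_poly_ge0.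
- apply: (coef_p_poly_le m0 MmK) => k ks; rewrite P.
  (* As [pi / 2] is itself a multiple of [h], it never lies strictly between [k h] and [(k+1) h], so
     the two cosines do not have opposite signs. *)
  suff : 0 <= cos (k%:R * h) * cos (k.+1%:R * h) by lra.
  have [sk|sk] := ltnP k s./2; first by rewrite mulr_ge0 ?cos_ge0 //; lia.
  by rewrite mulr_le0 ?cos_le0 //; lia.
- rewrite /coef_seq coef_p_poly; last lia.
  rewrite prednK; last lia.
  by rewrite /sin_quot P halfE cos_pihalf mul0r subr0 mulrAC MmK divff //
             gt_eqF ?sin_quot_den_gt0.
Qed.

Lemma factor_boundP r : 1 <= r ->
  factor_log_concave r (coef_seq p_poly) <-> (r%:E <= factor_bound R s)%E.
Proof.
move=> r1; have c0 := cos_angle_gt0; have c1 := cos_angle_lt1.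
have S1 : 0 < msin h 1 by apply: msin_gt0; lia.
(* The odd denominator is controlled by the sign of [sin 3h], which is zero for [s = 3] and positive
   for [s > 3]. *)
have S3 : msin h 3 = (2 * cos h - 1) * ((2 * cos h + 1) * msin h 1).
  by rewrite (msinSS h 1) msin2 msin1; ring.
have c21 : 0 < (2 * cos h + 1) * msin h 1 by rewrite mulr_gt0 //; lra.
rewrite /factor_bound -/h; case: ifPn => [s_odd|s_even].
- rewrite factor_p_poly_odd //; case: ifPn => s3.
  + rewrite leey; split=> // _; move: S3.
    have -> : msin h 3 = 0 by rewrite -[RHS]msin_s (eqP s3).
    move=> /esym/eqP; rewrite mulf_eq0 (gt_eqF c21) orbF.
    move=> /eqP c; have -> : 1 - 2 * cos h = 0 by lra.
    by rewrite expr0n mulr0 ler01.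
  + rewrite lee_fin ler_pdivlMr // exprn_even_gt0 //=.
    have : 0 < msin h 3 by apply: msin_gt0; lia.
    by rewrite S3 pmulr_lgt0 // => c; rewrite lt_eqF //; lra.
- rewrite factor_p_poly_even // -mulrA -/h; case: ifPn => s4.
  + rewrite leey; split=> // _.
    have -> : 2 * h = pi / 2 by rewrite /h (eqP s4); field.
    by rewrite cos_pihalf mulr0 ler01.
  + rewrite lee_fin ler_pdivlMr //; apply: cos_gt0_pihalf.
    have : 2 * h < pi / 2.
      (* An even [s] other than [4] exceeds [5], so [4h < 5h <= pi]. *)
      have := mul_s_angle; have : 5%:R * h <= s%:R * h.
        by rewrite ler_pM2r ?angle_gt0 // ler_nat; lia.
      by have := angle_gt0; lra.
    by have := angle_gt0; have := @pi_gt0 R; lra.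
Qed.

End RootsOfUnityAngle.

Theorem theorem3p7 (R : realType) (s : nat) (hs : (3 <= s)%N) :
  exists p : {poly R},
    FracField.tofrac p = p_frac R s /\
    (size p = (s - 3).+1 /\ palindromic p) /\
    (forall n : nat, (n <= s - 3)%N -> 0 < coef_seq p n) /\
    fixed_by_logL (coef_seq p) /\
    infinitely_log_concave (coef_seq p) /\
    (forall r : R, 1 <= r ->
       (factor_log_concave r (coef_seq p) <-> (r%:E <= factor_bound R s)%E)).
Proof.
exists (p_poly s); split; first exact: tofrac_p_poly.
split; first by split; [exact: size_p_poly|exact: palindromic_p_poly].
split; first exact: coef_p_poly_gt0.
split; first exact: fixed_p_poly.
split; last exact: factor_boundP.
by apply: fixed_infinitely_log_concave; [exact: fixed_p_poly|exact: coef_p_poly_ge0].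
Qed.
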